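(* Let $\mathcal{S}$ be a pseudo-regular subspace of a Krein space $\mathcal{H}$ with fundamental symmetry $J$, and let $Q_0$ be a projection in $\mathcal{Q}_{\mathcal{S}}$. Then the map $$p_{Q_0}:\mathcal{U}_{\mathcal{S}}\to\mathcal{Q}_{\mathcal{S}},\qquad p_{Q_0}(U)=UQ_0U^{\#},$$ has a global continuous cross section, i.e. there is a continuous map $s:\mathcal{Q}_{\mathcal{S}}\to\mathcal{U}_{\mathcal{S}}$ such that $p_{Q_0}(s(Q))=Q$ for every $Q\in\mathcal{Q}_{\mathcal{S}}$.
   Context: $(\mathcal{H},\langle\cdot,\cdot\rangle)$ is a complex separable Hilbert space, $L(\mathcal{H})$ its algebra of bounded operators, $J\in L(\mathcal{H})$ a fixed symmetry ($J=J^*=J^{-1}$), $[f,g]=\langle Jf,g\rangle$, and $T^{\#}=JT^*J$. For a subspace $\mathcal{S}$, $\mathcal{S}^{[\perp]}=\{f:[f,g]=0\ \forall g\in\mathcal{S}\}$ and $\mathcal{S}^{\circ}=\mathcal{S}\cap\mathcal{S}^{[\perp]}$; $[\dot{+}]$ is $J$-orthogonal direct sum. A closed subspace $\mathcal{M}$ is regular if $\mathcal{M}[\dot{+}]\mathcal{M}^{[\perp]}=\mathcal{H}$. A closed subspace $\mathcal{S}$ is pseudo-regular if $\mathcal{S}=\mathcal{S}^{\circ}[\dot{+}]\mathcal{M}$ for some regular $\mathcal{M}$. $\mathcal{Q}_{\mathcal{S}}=\{Q\in L(\mathcal{H}):Q^2=Q,\ QQ^{\#}=Q^{\#}Q,\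 R(Q)=\mathcal{S}\}$ is the set of $J$-normal projections with range $\mathcal{S}$, and $\mathcal{U}_{\mathcal{S}}=\{U\in L(\mathcal{H}):UU^{\#}=U^{\#}U=I,\ U(\mathcal{S})=\mathcal{S}\}$. Both carry the norm topology inherited from $L(\mathcal{H})$. *)

(* Defs.v *)
From HB Require Import structures.
From mathcomp Require Import all_boot all_order all_algebra.
From mathcomp Require Import all_classical all_reals all_analysis.
From mathcomp.real_closed Require Import complex.

Set Implicit Arguments.
Unset Strict Implicit.
Unset Printing Implicit Defensive.

Import Order.TTheory GRing.Theory Num.Theory.
Import numFieldNormedType.Exports.

Local Open Scope classical_set_scope.
Local Open Scope ring_scope.
Local Open Scope complex_scope.

Section BoundedOperators.
Context {R : realType} {H : normedModType R[i]}.

Definition is_bounded_op : {pred (H -> H)} :=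
  [pred f : H -> H | `[< linear f /\
    exists2 M : R[i], 0 <= M & forall x, `|f x| <= M * `|x| >]].

Fact is_bounded_op_submod : submod_closed is_bounded_op.
Proof.
split.
  apply/asboolP; split.
    by move=> a x y; rewrite -![GRing.zero _]/(0 : H) scaler0 addr0.
  by exists 0 => // x; rewrite mul0r normr0.
move=> a f g /asboolP[lf [M M0 fM]] /asboolP[lg [N N0 gN]].
apply/asboolP; split.
  move=> b x y; rewrite !fctE lf lg !scalerDr !addrA; congr (_ + _).
  by rewrite addrAC !scalerA mulrC.
exists (`|a| * M + N) => [|x]; first by rewrite addr_ge0// mulr_ge0.
rewrite !fctE mulrDl -mulrA (le_trans (ler_normD _ _))// lerD//.
by rewrite normrZ ler_wpM2l.
Qed.

HB.instance Definition _ :=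
  GRing.isSubmodClosed.Build _ _ is_bounded_op is_bounded_op_submod.

End BoundedOperators.

Record bop (R : realType) (H : normedModType R[i]) := Bop {
  bop_fun :> H -> H;
  bop_subproof : bop_fun \in is_bounded_op }.

Section BopAlgebra.
Context {R : realType} {H : normedModType R[i]}.

HB.instance Definition _ := [isSub for @bop_fun R H].
HB.instance Definition _ := [Choice of bop H by <:].
HB.instance Definition _ := [SubChoice_isSubLmodule of bop H by <:].

Lemma bop_linear (T : bop H) : linear T.
Proof. by have /asboolP[] := bop_subproof T. Qed.

HB.instance Definition _ (T : bop H) :=
  GRing.isLinear.Build R[i] H H *:%R T (bop_linear T).

Lemma bop_bounded (T : bop H) :
  exists2 M : R[i], 0 <= M & forall x, `|T x| <= M * `|x|.
Proof. by have /asboolP[] := bop_subproof T. Qed.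

Lemma bopP (S T : bop H) : (forall x, S x = T x) -> S = T.
Proof. by move=> ST; apply/val_inj/funext. Qed.

Fact bop_id_subproof : (@idfun H) \in is_bounded_op.
Proof. by apply/asboolP; split => //; exists 1 => // x; rewrite mul1r. Qed.
Definition bop_id := Bop bop_id_subproof.

Fact bop_comp_subproof (S T : bop H) : S \o T \in is_bounded_op.
Proof.
apply/asboolP; split; first by move=> a x y; rewrite /= !linearP.
have [[M M0 SM] [N N0 TN]] := (bop_bounded S, bop_bounded T).
exists (M * N) => [|x]; first exact: mulr_ge0.
by rewrite (le_trans (SM _))// -mulrA ler_wpM2l.
Qed.
Definition bop_comp S T := Bop (bop_comp_subproof S T).

Fact bop_compA : associative bop_comp.
Proof. by move=> A B C; exact: bopP. Qed.
Fact bop_comp1l : left_id bop_id bop_comp.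
Proof. by move=> A; exact: bopP. Qed.
Fact bop_comp1r : right_id bop_id bop_comp.
Proof. by move=> A; exact: bopP. Qed.
Fact bop_compDl : left_distributive bop_comp +%R.
Proof. by move=> A B C; exact: bopP. Qed.
Fact bop_compDr : right_distributive bop_comp +%R.
Proof. by move=> A B C; apply: bopP => x /=; exact: linearD. Qed.

(* [1] is the identity operator and [S * T] is [S \o T]. *)
HB.instance Definition _ := GRing.Zmodule_isPzRing.Build (bop H)
  bop_compA bop_comp1l bop_comp1r bop_compDl bop_compDr.

End BopAlgebra.

Section OperatorNorm.
Context {R : realType} {H : normedModType R[i]}.
Implicit Types S T : bop H.

(* Norms on [H] take (real) values in [R[i]], hence the real part. *)
Definition unit_ball_norms T : set R :=
  [set complex.Re `|T x| | x in [set x : H | `|x| <= 1]].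

Definition opnorm T : R[i] := (sup (unit_ball_norms T))%:C.

Lemma normRe (x : H) : `|x| = (complex.Re `|x|)%:C.
Proof.
have : 0 <= `|x| by [].
by case: `|x| => a b; rewrite lecE /= => /andP[/eqP-> _].
Qed.

Lemma unit_ball_norms_has_sup T : has_sup (unit_ball_norms T).
Proof.
split; first by exists (complex.Re `|T 0|); exists 0 => //=; rewrite normr0.
have [M M0 TM] := bop_bounded T; exists (complex.Re M) => _ [x /= x1 <-].
have := le_trans (TM x) (ler_piMr M0 x1).
by rewrite lecE => /andP[].
Qed.

Lemma opnorm_ge0 T : 0 <= opnorm T.
Proof.
rewrite lecR; apply: (@le_trans _ _ (complex.Re `|T 0|)); last first.
  apply: sup_ubound; first by case: (unit_ball_norms_has_sup T).
  by exists 0 => //=; rewrite normr0.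
by rewrite linear0 normr0.
Qed.

Lemma opnorm_unit T x : `|x| <= 1 -> `|T x| <= opnorm T.
Proof.
move=> x1; rewrite normRe lecR.
by apply: sup_ubound; [case: (unit_ball_norms_has_sup T)|exists x].
Qed.

Lemma opnorm_le T (M : R[i]) :
  (forall x, `|x| <= 1 -> `|T x| <= M) -> opnorm T <= M.
Proof.
move=> TM; have := TM 0; rewrite normr0 linear0 normr0 => /(_ ler01) M0.
have -> : M = (complex.Re M)%:C.
  by case: M M0 {TM} => a b; rewrite lecE /= => /andP[/eqP-> _].
rewrite lecR; apply: ge_sup; first by case: (unit_ball_norms_has_sup T).
by move=> _ [x /= x1 <-]; have := TM _ x1; rewrite lecE => /andP[].
Qed.

Lemma opnormD S T : opnorm (S + T) <= opnorm S + opnorm T.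
Proof.
apply: opnorm_le => x x1; apply: (le_trans (ler_normD _ _)).
by apply: lerD; exact: opnorm_unit.
Qed.

Lemma opnormP T x : `|T x| <= opnorm T * `|x|.
Proof.
have [->|x0] := eqVneq x 0; first by rewrite linear0 !normr0 mulr0.
have nx0 : 0 < `|x| by rewrite normr_gt0.
rewrite -ler_pdivrMr// mulrC -[`|x|^-1]ger0_norm ?invr_ge0// -normrZ -linearZ.
by apply: opnorm_unit; rewrite normrZ ger0_norm ?invr_ge0// mulVf// gt_eqF.
Qed.

Lemma opnormZ (l : R[i]) T : opnorm (l *: T) = `|l| * opnorm T.
Proof.
have le_Z (k : R[i]) S : opnorm (k *: S) <= `|k| * opnorm S.
  apply: opnorm_le => x x1; rewrite [X in `|X|]/= normrZ.
  by rewrite ler_wpM2l// opnorm_unit.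
apply/eqP; rewrite eq_le le_Z /=.
have [->|l0] := eqVneq l 0; first by rewrite normr0 mul0r opnorm_ge0.
have := le_Z l^-1 (l *: T); rewrite scalerA mulVf// scale1r normfV.
by rewrite ler_pdivlMl ?normr_gt0.
Qed.

Lemma opnorm0_eq0 T : opnorm T = 0 -> T = 0.
Proof.
move=> T0; apply: bopP => x; apply/eqP; rewrite -normr_le0.
by rewrite (le_trans (opnormP T x))// T0 mul0r.
Qed.

(* This makes [bop H] a normedModType, with its norm topology. *)
HB.instance Definition _ :=
  Lmodule_isNormed.Build R[i] (bop H) opnormD opnormZ opnorm0_eq0.

End OperatorNorm.

Notation "''L' ( H )" := (bop H) (at level 8, format "''L' ( H )") : type_scope.

Definition separable_space (T : topologicalType) :=
  exists2 D : set T, countable D & dense D.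

Section KreinSpace.
Context {R : realType} {H : completeNormedModType R[i]}.

(* [dot] is linear in its first argument, conjugate-linear in the second. *)
Variable dot : {dot H for Num.conj}.

Definition hilbert_norm := forall x : H, `|x| ^+ 2 = dot x x.

(* Under [hilbert_norm] the adjoint exists (Riesz) and is unique, so the default
   value 0 is never used. *)
Definition adjoint (T : 'L(H)) : 'L(H) :=
  xget 0 [set T' : 'L(H) | forall x y, dot (T x) y = dot x (T' y)].

Definition symmetry (J : 'L(H)) := J = adjoint J /\ J * J = 1.

Definition linear_subspace (S : set H) :=
  S 0 /\ forall (a : R[i]) x y, S x -> S y -> S (a *: x + y).

Variable J : 'L(H).

Definition krein_form (f g : H) : R[i] := dot (J f) g.

Definition krein_adjoint (T : 'L(H)) : 'L(H) := J * adjoint T * J.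

Definition krein_orth (S : set H) : set H :=
  [set f | forall g, S g -> krein_form f g = 0].

Definition isotropic_part (S : set H) : set H := S `&` krein_orth S.

Definition krein_direct_sum (A B V : set H) :=
  [/\ forall a b, A a -> B b -> krein_form a b = 0,
      A `&` B = [set 0] &
      [set a + b | a in A & b in B] = V].

Definition regular (M : set H) :=
  [/\ linear_subspace M, closed M & krein_direct_sum M (krein_orth M) setT].

Definition pseudo_regular (S : set H) :=
  [/\ linear_subspace S, closed S &
      exists2 M, regular M & krein_direct_sum (isotropic_part S) M S].

Definition J_normal_projections (S : set H) : set 'L(H) :=
  [set Q | [/\ Q * Q = Q,
               Q * krein_adjoint Q = krein_adjoint Q * Q &
               range Q = S]].

Definition J_unitaries (S : set H) : set 'L(H) :=
  [set U | [/\ U * krein_adjoint U = 1,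
               krein_adjoint U * U = 1 &
               U @` S = S]].

Definition conj_map (Q0 U : 'L(H)) : 'L(H) := U * Q0 * krein_adjoint U.

End KreinSpace.

(* Main.v *)
Require Import Defs.
From HB Require Import structures.
From mathcomp Require Import all_boot all_order all_algebra.
From mathcomp Require Import all_classical all_reals all_analysis.
From mathcomp.real_closed Require Import complex.
From mathcomp Require Import ring lra.

Set Implicit Arguments.
Unset Strict Implicit.
Unset Printing Implicit Defensive.

Import Order.TTheory GRing.Theory Num.Theory.
Import numFieldNormedType.Exports.

Local Open Scope classical_set_scope.
Local Open Scope ring_scope.

(** Why the cross section exists.  In the ring of bounded operators the map
    [T |-> T^#] is an involution.  A [J]-normal projection [Q] commutes with
    [Q^#], so the four products

      [Q Q^#],  [Q (1 - Q^#)],  [(1 - Q) Q^#],  [(1 - Q) (1 - Q^#)]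

    are mutually orthogonal idempotents with sum 1; write them [e_ab(Q)], where
    [a] and [b] tell whether [Q] and [Q^#] or their complements occur.  The
    involution exchanges [e_ab(Q)] and [e_ba(Q)], and [Q] is the sum of the two
    corners that contain the factor [Q].  Geometrically the ranges are a regular
    complement of the isotropic part of [S] in [S], the isotropic part itself, a
    neutral space in duality with it, and a regular subspace completing the
    decomposition.

    If [Q] and [Q0] have the same range, that is [Q Q0 = Q0] and [Q0 Q = Q], then
    [e_ab(Q) e_ab(Q0) e_ab(Q) = e_ab(Q)] for every corner: passing to the
    corresponding corner of the other projection and back loses nothing
    ([corner_sandwich]).  Hence

      [U(Q) = \sum_ab e_ab(Q) e_ab(Q0)]

    has the two-sided inverse [\sum_ab e_ab(Q0) e_ab(Q)], which is [U(Q)^#]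
    ([mul_proj_intertwiner], [star_proj_intertwiner]), and it satisfies
    [U(Q) Q0 = Q U(Q)] ([proj_intertwinerE]).  So [U(Q)] is [J]-unitary, maps [S]
    onto [S] and conjugates [Q0] to [Q].  It is a polynomial in [Q] and [Q^#],
    hence continuous in [Q] as soon as products and adjoints are continuous for
    the operator norm.

    The existence, the algebraic rules and the norm bound of the Hilbert space
    adjoint come from the Riesz representation theorem ([riesz]), proved by
    minimising the energy [|x|^2 - 2 Re (f x)]. *)

(** * Intertwining two families of orthogonal idempotents *)

Section IntertwinedIdempotents.
Context {A : pzRingType} {I : finType}.
Variables e f : I -> A.
Hypotheses (e_ortho : forall i j, i != j -> e i * e j = 0)
           (f_ortho : forall i j, i != j -> f i * f j = 0)
           (e_idem : forall i, e i * e i = e i)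
           (f_idem : forall i, f i * f i = f i)
           (efe : forall i, e i * f i * e i = e i).

Lemma mul_sum_diag (x y : I -> A) : (forall i j, i != j -> x i * y j = 0) ->
  (\sum_i x i) * (\sum_i y i) = \sum_i x i * y i.
Proof.
move=> xy0; rewrite mulr_suml; apply: eq_bigr => i _.
by rewrite mulr_sumr (bigD1 i)//= big1 ?addr0// => j ji; rewrite xy0// eq_sym.
Qed.

(** Orthogonality of the [f i] kills the cross terms [e i f i f j e j], so that
    only the products [e i f i e i = e i] survive. *)
Lemma intertwiner_mul :
  (\sum_i e i * f i) * (\sum_i f i * e i) = \sum_i e i.
Proof.
rewrite mul_sum_diag => [|i j ij]; last first.
  by rewrite mulrA -(mulrA (e i)) f_ortho// mulr0 mul0r.
by apply: eq_bigr => i _; rewrite mulrA -(mulrA (e i)) f_idem efe.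
Qed.

(** Both sides reduce to [e k f k]: the sum carries the [k]-th idempotent of one
    family to that of the other. *)
Lemma intertwinerE k :
  (\sum_i e i * f i) * f k = e k * (\sum_i e i * f i).
Proof.
transitivity (e k * f k).
  rewrite mulr_suml (bigD1 k)//= -mulrA f_idem big1 ?addr0// => i ik.
  by rewrite -mulrA f_ortho// mulr0.
rewrite mulr_sumr (bigD1 k)//= mulrA e_idem big1 ?addr0// => i ik.
by rewrite mulrA e_ortho ?mul0r// eq_sym.
Qed.

End IntertwinedIdempotents.

(** * Normal projections in a ring with involution *)

Section NormalProjections.
Context {A : pzRingType}.

Definition involution (star : A -> A) :=
  [/\ involutive star, {morph star : x y / x + y},
      {morph star : x y / x * y >-> y * x} & star 1 = 1].

Definition normal_projection (star : A -> A) (p : A) :=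
  p * p = p /\ p * star p = star p * p.

Definition proj_side (b : bool) (p : A) := if b then p else 1 - p.

(** The idempotents [e_ab]: the boolean [i.1] selects [p] or [1 - p], and [i.2]
    selects [star p] or [1 - star p]. *)
Definition corner (star : A -> A) (p : A) (i : bool * bool) :=
  proj_side i.1 p * proj_side i.2 (star p).

Definition proj_intertwiner (star : A -> A) (p q : A) :=
  \sum_(i : bool * bool) corner star p i * corner star q i.

Lemma sum_bool_pair (x : bool * bool -> A) :
  \sum_i x i = x (true, true) + x (true, false) +
               (x (false, true) + x (false, false)).
Proof.
rewrite -(eq_bigr _ (fun i _ => congr1 x (esym (surjective_pairing i)))).
by rewrite -(pair_bigA _ (fun a b => x (a, b)))/= big_bool/= !big_bool.
Qed.

Lemma mul_proj_side b c p : p * p = p ->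
  proj_side b p * proj_side c p = if b == c then proj_side b p else 0.
Proof.
move=> pp; case: b; case: c => //=.
- by rewrite mulrBr mulr1 pp subrr.
- by rewrite mulrBl mul1r pp subrr.
- by rewrite mulrBl mul1r mulrBr mulr1 pp subrr subr0.
Qed.

Lemma comm_proj_side b c p q : GRing.comm p q ->
  GRing.comm (proj_side b p) (proj_side c q).
Proof.
have commB x y : GRing.comm x y -> GRing.comm (1 - x) y.
  by move=> /commr_sym xy; apply/commr_sym/commrB => //; exact: commr1.
move=> pq; have bpq : GRing.comm (proj_side b p) q.
  by case: b => //; exact: commB.
by case: c => //=; apply/commr_sym/commB/commr_sym.
Qed.

Variables (star : A -> A) (starP : involution star).

Let starK : involutive star. Proof. by case: starP. Qed.
Let starD : {morph star : x y / x + y}. Proof. by case: starP. Qed.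
Let starM x y : star (x * y) = star y * star x. Proof. by case: starP. Qed.
Let star1 : star 1 = 1. Proof. by case: starP. Qed.
Let starB x y : star (x - y) = star x - star y.
Proof. by apply: (addIr (star y)); rewrite -starD !subrK. Qed.

Lemma star_proj_side b p : star (proj_side b p) = proj_side b (star p).
Proof. by case: b => //=; rewrite starB star1. Qed.

(** The condition [p * q = q], [q * p = p] says that [p] and [q] have the same
    range; the complements then have the same kernel, and in both cases
    multiplying by [q] between two copies of [p] does nothing. *)
Lemma proj_side_sandwich b p q : p * p = p -> p * q = q -> q * p = p ->
  proj_side b p * (proj_side b q * proj_side b p) = proj_side b p.
Proof.
move=> pp pq qp; case: b => /=; first by rewrite qp pp.
have absorb (x y : A) : x * y = y -> (1 - x) * (1 - y) = 1 - x.
  by move=> xy; rewrite mulrBr mulr1 mulrBl mul1r xy subrr subr0.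
by rewrite (absorb q p)// (absorb p q).
Qed.

Section Corners.
Variables (p : A) (pN : normal_projection star p).
Let pp : p * p = p. Proof. by case: pN. Qed.
Let spp : star p * star p = star p. Proof. by rewrite -starM pp. Qed.
Let pC : GRing.comm p (star p). Proof. by case: pN. Qed.

(** The four factors commute, so the product is taken factor by factor, and
    [p], [1 - p] are orthogonal, as are their images under the involution. *)
Lemma mul_corner i j :
  corner star p i * corner star p j = if i == j then corner star p i else 0.
Proof.
case: i j => [a b] [c d]; rewrite /corner/= mulrA -(mulrA (proj_side a p)).
rewrite -(comm_proj_side c b pC) mulrA mul_proj_side// -mulrA mul_proj_side//.
by rewrite xpair_eqE; do 2!case: eqP => _; rewrite ?mul0r ?mulr0.
Qed.

Lemma corner_orthogonal_idempotents :
  (forall i j, i != j -> corner star p i * corner star p j = 0) /\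
  (forall i, corner star p i * corner star p i = corner star p i).
Proof.
by split=> [i j /negbTE|i]; rewrite mul_corner ?eqxx// => ->.
Qed.

Lemma sum_corner : \sum_i corner star p i = 1.
Proof.
by rewrite sum_bool_pair /corner/= -!mulrDr addrC !(addrC _ (1 - _)) !subrK
  !mulr1 subrK.
Qed.

(** Normality is what keeps the swapped product a corner: the involution
    reverses the two factors, and they commute. *)
Lemma star_corner a b : star (corner star p (a, b)) = corner star p (b, a).
Proof.
by rewrite /corner/= starM !star_proj_side starK (comm_proj_side _ _ pC).
Qed.

Lemma corner_range :
  corner star p (true, true) + corner star p (true, false) = p.
Proof. by rewrite /corner/= -mulrDr addrC subrK mulr1. Qed.

End Corners.

Section SameRange.
Variables p q : A.
Hypotheses (pN : normal_projection star p) (qN : normal_projection star q)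
           (pq : p * q = q) (qp : q * p = p).

(** In each corner one of the two commuting factors can be moved next to the
    other projection.  Where the first factors have the same range they
    absorb each other from one side, where they have the same kernel from the
    other side; what remains is the sandwich of the second factors, the
    image under the involution of [proj_side_sandwich]. *)
Lemma corner_sandwich i :
  corner star p i * corner star q i * corner star p i = corner star p i.
Proof.
have [[pp pC] [qq qC]] := (pN, qN).
case: i => a b; rewrite /corner/=.
have := comm_proj_side a b pC; have := comm_proj_side a b qC.
have : proj_side b (star p) * proj_side b (star q) * proj_side b (star p) =
       proj_side b (star p).
  by rewrite -!star_proj_side -!starM proj_side_sandwich.
move: (proj_side b (star p)) (proj_side b (star q)) => y w ywy.
rewrite /GRing.comm; case: a => /= qC' pC'.
  (* same range: [p * q = q] first, then [q * p = p] *)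
  by rewrite {1}pC' -(mulrA y) (mulrA p) pq qC' !mulrA -(mulrA _ q) qp -mulrA
    pC' mulrA ywy.
(* same kernel: [(1 - p) * (1 - q) = 1 - p] removes the middle factor *)
rewrite {1}pC' -(mulrA y) (mulrA _ (1 - q)).
have -> : (1 - p) * (1 - q) = 1 - p.
  by rewrite mulrBr mulr1 mulrBl mul1r pq subrr subr0.
have yw : y * (w * (y * (1 - p))) = y * (1 - p) by rewrite !mulrA ywy.
rewrite !mulrA -pC' -3!mulrA pC' yw -pC' mulrA.
by rewrite (@mul_proj_side false false).
Qed.
End SameRange.

Lemma conj_normal_projection u p : star u * u = 1 ->
  normal_projection star p -> normal_projection star (u * p * star u).
Proof.
move=> vu [pp pC].
have conjM a b : u * a * star u * (u * b * star u) = u * (a * b) * star u.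
  by rewrite !mulrA -[u * a * _ * u]mulrA vu mulr1.
have starE : star (u * p * star u) = u * star p * star u.
  by rewrite !starM starK mulrA.
by split; rewrite ?starE !conjM ?pp ?pC.
Qed.

Lemma mul_proj_intertwiner p q :
  normal_projection star p -> normal_projection star q ->
  p * q = q -> q * p = p ->
  proj_intertwiner star p q * proj_intertwiner star q p = 1.
Proof.
move=> pN qN pq qp.
have [q_ortho q_idem] := corner_orthogonal_idempotents qN.
by rewrite intertwiner_mul ?sum_corner//; exact: corner_sandwich.
Qed.

Lemma proj_intertwinerE p q :
  normal_projection star p -> normal_projection star q ->
  proj_intertwiner star p q * q = p * proj_intertwiner star p q.
Proof.
move=> pN qN; rewrite -{2}(corner_range p) -{2}(corner_range q).
have [p_ortho p_idem] := corner_orthogonal_idempotents pN.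
have [q_ortho q_idem] := corner_orthogonal_idempotents qN.
by rewrite mulrDr mulrDl !intertwinerE.
Qed.

Lemma star_proj_intertwiner p q :
  normal_projection star p -> normal_projection star q ->
  star (proj_intertwiner star p q) = proj_intertwiner star q p.
Proof.
move=> pN qN; rewrite /proj_intertwiner !sum_bool_pair !starD.
have star_term a b : star (corner star p (a, b) * corner star q (a, b)) =
    corner star q (b, a) * corner star p (b, a).
  by rewrite starM !star_corner.
by rewrite !star_term -!addrA; congr (_ + _); rewrite addrCA.
Qed.

End NormalProjections.

(** * The Riesz representation theorem *)

Section Riesz.
Context {R : realType} {H : completeNormedModType R[i]}.
Variable dot : {dot H for Num.conj}.
Hypothesis hilbertH : hilbert_norm dot.

Lemma dotC u v : dot u v = (dot v u)^*.
Proof. by rewrite hermC expr0 mul1r. Qed.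

Lemma dot_inj u v : (forall x, dot x u = dot x v) -> u = v.
Proof.
move=> uv; apply/eqP; rewrite -subr_eq0 -(dnorm_eq0 dot).
by rewrite linearBr/= uv subrr.
Qed.

(** Cauchy-Schwarz: [u - a *: v] is orthogonal to [v] and has nonnegative
    square norm. *)
Lemma dot_normM u v : `|dot u v| <= `|u| * `|v|.
Proof.
have [->|v0] := eqVneq v 0; first by rewrite linear0r !normr0 mulr0.
have vv : 0 < dot v v by rewrite dnorm_gt0.
rewrite -ler_sqr ?nnegrE ?mulr_ge0// exprMn !hilbertH.
pose a := dot u v / dot v v.
have ov : dot (u - a *: v) v = 0.
  by rewrite linearBl linearZl_LR /= divfK ?gt_eqF// subrr.
have := dnorm_ge0 dot (u - a *: v).
rewrite linearBr linearZr_LR /= ov mulr0 subr0 linearBl linearZl_LR /=.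
by rewrite (dotC v u) /a mulrAC -normCK subr_ge0 ler_pdivrMr.
Qed.

Section Functional.
Variables (f : H -> R[i]) (M : R[i]).
Hypotheses (fP : forall a x y, f (a *: x + y) = a * f x + f y)
           (M0 : 0 <= M) (fM : forall x, `|f x| <= M * `|x|).

(** The energy [|x|^2 - 2 Re (f x)], whose minimiser represents [f]. *)
Let energy (x : H) : R := complex.Re (dot x x - (f x + (f x)^*)).

Let energy_nonempty : range energy !=set0.
Proof. by exists (energy 0); exists 0. Qed.

Let energy_lbound : has_lbound (range energy).
Proof.
exists (- complex.Re (M ^+ 2)) => _ [x _ <-]; rewrite /energy.
rewrite -subr_ge0 opprK -raddfD /=.
suff : 0 <= dot x x - (f x + (f x)^*) + M ^+ 2 by rewrite lecE => /andP[].
rewrite -hilbertH.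
(* by the bound on [f], the sum is at least [(|x| - M)^2] *)
have fJ : f x + (f x)^* <= (M * `|x|) *+ 2.
  rewrite (_ : f x + _ = ((complex.Re (f x))%:C)%C *+ 2); last first.
    by rewrite -mulr_natl -[RHS]addcJ.
  rewrite lerMn2r/= (le_trans _ (fM x))// (le_trans _ (normc_ge_Re _))//.
  by rewrite lecR ler_norm.
have xM : `|x| - M \is Num.real by rewrite rpredB// ger0_real.
rewrite (le_trans (real_exprn_even_ge0 (n := 2) xM _))//.
rewrite sqrrB lerD2r lerD2l lerN2 mulrC (le_trans fJ)//.
Qed.

(** A point [u] whose energy is within [d ^ 2] of the infimum represents [f]
    up to [d]: with [e := dot h u - f h], moving from [u] along [h] by the
    optimal amount lowers the energy by [|e|^2 / |h|^2], which cannot exceed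
    [d ^ 2]. *)
Lemma approx_riesz (d : R) : 0 < d ->
  exists u, forall h, `|dot h u - f h| <= (d%:C)%C * `|h|.
Proof.
move=> d0.
have [_ [u _ <-] uE] := inf_adherent (exprn_gt0 2 d0)
  (conj energy_nonempty energy_lbound).
exists u => h.
have f0 : f 0 = 0.
  by have := fP 1 0 0; rewrite scaler0 mul1r !addr0 -[LHS]add0r => /addIr ->.
have [->|h0] := eqVneq h 0; first by rewrite linear0l f0 subr0 !normr0 mulr0.
have hh : 0 < dot h h by rewrite dnorm_gt0.
set e := dot h u - f h.
have en (c : R[i]) : energy (c *: h + u) = energy u +
    complex.Re (c * e + (c * e)^* + `|c| ^+ 2 * dot h h).
  rewrite /energy -raddfD/=; congr complex.Re.
  rewrite fP hnormD/= expr0 mul1r dnormZ linearZl_LR/= /e.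
  rewrite !(rmorphD, rmorphM, rmorphB)/= !mulrBr.
  by rewrite !opprD; ring.
(* [c := - e^* / |h|^2] minimises the quadratic [en] *)
have := ge_inf energy_lbound (imageT energy (- (e^* / dot h h) *: h + u)).
have -> : energy (- (e^* / dot h h) *: h + u) =
    energy u - complex.Re (`|e| ^+ 2 / dot h h).
  rewrite en -raddfN; congr (_ + complex.Re _).
  rewrite !(rmorphM, rmorphN)/= conjCK fmorphV/= -dotC normrN normrM normfV.
  rewrite norm_conjC (gtr0_norm hh) exprMn !normCK.
  by field; rewrite gt_eqF.
move=> infE; have {infE} ed : complex.Re (`|e| ^+ 2 / dot h h) < d ^+ 2 by lra.
have dC : 0 <= (d%:C)%C by rewrite ler0c ltW.
rewrite -ler_sqr ?nnegrE ?mulr_ge0//.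
have edC : ((complex.Re (`|e| ^+ 2 / dot h h))%:C <= (d ^+ 2)%:C)%C.
  by rewrite lecR ltW.
rewrite exprMn hilbertH -ler_pdivrMr//; move: edC.
rewrite RRe_real ?rmorphXn//.
by rewrite ger0_real// divr_ge0 ?exprn_ge0// ltW.
Qed.

(** Test both approximations of [f] against [u - v] itself. *)
Let approx_dist u v (d1 d2 : R[i]) : 0 <= d1 -> 0 <= d2 ->
  (forall h, `|dot h u - f h| <= d1 * `|h|) ->
  (forall h, `|dot h v - f h| <= d2 * `|h|) -> `|u - v| <= d1 + d2.
Proof.
move=> d10 d20 ud vd; have [->|uv] := eqVneq `|u - v| 0; first exact: addr_ge0.
have uv0 : 0 < `|u - v| by rewrite lt_def uv normr_ge0.
rewrite -(ler_pM2r uv0) -expr2 hilbertH linearBr/=.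
rewrite -[leLHS]ger0_norm; last by rewrite -linearBr dnorm_ge0.
rewrite -(subrKA (f (u - v))) (le_trans (ler_normD _ _))// mulrDl.
by rewrite lerD// distrC.
Qed.

(** Approximate representers with errors tending to 0 form a Cauchy sequence
    by [approx_dist]; completeness provides the exact one. *)
Lemma riesz : exists y, forall h, f h = dot h y.
Proof.
have inv_gt0 n : 0 < n.+1%:R^-1 :> R by [].
have inv_ge0 n : 0 <= (n.+1%:R^-1%:C)%C :> R[i] by rewrite ler0c.
have [u uE] := choice (fun n => approx_riesz (inv_gt0 n)).
have tail (e : R[i]) : 0 < e -> \forall k \near \oo, (k.+1%:R^-1%:C)%C < e.
  move=> e0; near=> k; rewrite -[e]RRe_real ?gtr0_real// ltcR /=.
  near: k; have Re_e : 0 < complex.Re e by move: e0; rewrite ltcE => /andP[].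
  exact: (near_infty_natSinv_lt (PosNum Re_e)).
have u_cauchy : cauchy (u @ \oo).
  apply/cauchy_exP => e e0; have e20 : 0 < e / 2 by rewrite divr_gt0.
  have [n _ nE] := tail _ e20; exists (u n); exists n => // k nk.
  rewrite -ball_normE/=.
  rewrite (le_lt_trans (approx_dist (inv_ge0 _) (inv_ge0 _) (uE _) (uE _)))//.
  by rewrite [e]splitr ltrD// nE/=.
have uy : u @ \oo --> lim (u @ \oo) by exact: cauchy_cvg u_cauchy.
exists (lim (u @ \oo)) => h; apply/eqP; rewrite -subr_eq0 -normr_le0.
have [->|h0] := eqVneq h 0.
  have := uE 0%N 0; rewrite normr0 mulr0 linear0l sub0r normrN => /le_trans.
  by move=> f0; rewrite linear0l subr0 f0.
have {}h0 : 0 < `|h| by rewrite normr_gt0.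
apply/ler_addgt0Pr => e e0; rewrite add0r.
have eh0 : 0 < e / `|h| / 2 by rewrite !divr_gt0.
near \oo => k.
rewrite -(subrKA (dot h (u k))) (le_trans (ler_normD _ _))// distrC -linearBr/=.
rewrite [e]splitr lerD//.
  rewrite (le_trans (uE _ _))// -ler_pdivlMr// mulrAC.
  by apply: ltW; near: k; exact: tail.
rewrite (le_trans (dot_normM _ _))// mulrC -ler_pdivlMr// mulrAC distrC.
by near: k; move/cvgrPdist_le: uy; exact.
Unshelve. all: by end_near.
Qed.

End Functional.
End Riesz.

(** * Continuity of operator products *)

Section OperatorProducts.
Context {R : realType} {H : normedModType R[i]}.

Lemma opnormM (S T : 'L(H)) : `|S * T| <= `|S| * `|T|.
Proof.
apply: opnorm_le => x x1; apply: (le_trans (opnormP S (T x))).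
by apply: ler_pM; rewrite ?opnorm_ge0 ?opnorm_unit.
Qed.

Lemma cvg_mul_null {K : numFieldType} {I : Type} (F : set_system I)
    {FF : Filter F} (u v w : I -> K) (b c : K) :
  u @ F --> (0 : K) -> v @ F --> b -> w @ F --> (0 : K) ->
  (fun i => u i * v i + c * w i) @ F --> (0 : K).
Proof.
move=> u0 vb w0.
have uv0 : (u \* v) @ F --> (0 : K^o) by rewrite -(mul0r b); exact: cvgM.
have cw0 : (fun i => c * w i) @ F --> (0 : K^o).
  by rewrite -(mulr0 c); apply: cvgM => //; exact: cvg_cst.
by rewrite -(addr0 0); exact: (cvgD uv0 cw0).
Qed.

(** Write [f g - a b] as [(f - a) g + a (g - b)] and bound the two terms by
    the product of the norms. *)
Lemma cvg_bopM {I : Type} (F : set_system I) {FF : Filter F}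
    (f g : I -> 'L(H)) (a b : 'L(H)) :
  f @ F --> a -> g @ F --> b -> (fun i => f i * g i) @ F --> a * b.
Proof.
move=> fa gb; apply/subr_cvg0.
have /norm_cvg0P fa0 : (fun i => f i - a) @ F --> 0 by apply/subr_cvg0.
have /norm_cvg0P gb0 : (fun i => g i - b) @ F --> 0 by apply/subr_cvg0.
have := @cvg_mul_null _ I F _ _ _ _ _ `|a| fa0 (cvg_norm gb) gb0.
move=> /(_ FF FF)/cvgr0Pnorm_le fg0; apply/cvgr0Pnorm_le => e e0.
apply: filterS (fg0 _ e0) => i; apply: le_trans.
rewrite [leRHS]ger0_norm; last first.
  by rewrite addr_ge0// mulr_ge0.
rewrite -(subrKA (a * g i)) -mulrBl -mulrBr (le_trans (ler_normD _ _))//.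
by rewrite lerD// opnormM.
Qed.

Lemma cvg_proj_side {I : Type} (F : set_system I) {FF : Filter F} c
    (f : I -> 'L(H)) (a : 'L(H)) :
  f @ F --> a -> (fun i => proj_side c (f i)) @ F --> proj_side c a.
Proof.
by case: c => // fa; apply: cvgB => //; exact: cvg_cst.
Qed.

End OperatorProducts.

(** * Adjoints *)

Section Adjoint.
Context {R : realType} {H : completeNormedModType R[i]}.
Variable dot : {dot H for Num.conj}.
Hypothesis hilbertH : hilbert_norm dot.
Implicit Types S T : 'L(H).

(** Riesz's theorem represents [x |-> dot (T x) y] by a vector [T' y]; the
    bound of [T'] comes from [|T' y|^2 = dot (T (T' y)) y]. *)
Lemma adjoint_exists T :
  exists2 T' : 'L(H), forall x y, dot (T x) y = dot x (T' y) &
                      forall y, `|T' y| <= opnorm T * `|y|.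
Proof.
have represented y : exists z, forall x, dot (T x) y = dot x z.
  apply: (@riesz _ _ _ hilbertH (fun x => dot (T x) y) (opnorm T * `|y|)).
  - by move=> a u v; rewrite linearP linearPl.
  - by rewrite mulr_ge0// opnorm_ge0.
  - move=> x; rewrite (le_trans (dot_normM hilbertH _ _))// mulrAC ler_wpM2r//.
    exact: opnormP.
have [T' T'E] := choice represented.
have T'le y : `|T' y| <= opnorm T * `|y|.
  have [->|Ty] := eqVneq `|T' y| 0; first by rewrite mulr_ge0// opnorm_ge0.
  have Ty0 : 0 < `|T' y| by rewrite lt_def Ty normr_ge0.
  rewrite -(ler_pM2r Ty0) -expr2 hilbertH -T'E -[leLHS]ger0_norm; last first.
    by rewrite T'E dnorm_ge0.
  by rewrite (le_trans (dot_normM hilbertH _ _))// mulrAC ler_wpM2r// opnormP.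
have T'_bounded : T' \in is_bounded_op.
  apply/asboolP; split; last by exists (opnorm T) => //; exact: opnorm_ge0.
  move=> a u v; apply: (dot_inj (dot := dot)) => x.
  by rewrite -T'E !linearDr/= !linearZr_LR/= -!T'E.
by exists (Bop T'_bounded).
Qed.

Lemma adjointP T x y : dot (T x) y = dot x (adjoint dot T y).
Proof.
have [T' T'E _] := adjoint_exists T.
by have := @xgetPex _ 0 [set T' : 'L(H) | forall x y, dot (T x) y = dot x (T' y)];
  apply; exists T'.
Qed.

Lemma adjoint_unique S T :
  (forall x y, dot (T x) y = dot x (S y)) -> adjoint dot T = S.
Proof.
move=> TS; apply: bopP => y; apply: (dot_inj (dot := dot)) => x.
by rewrite -adjointP TS.
Qed.

Lemma adjoint_norm T : `|adjoint dot T| <= `|T|.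
Proof.
have [T' T'E T'le] := adjoint_exists T.
rewrite (adjoint_unique T'E); apply: opnorm_le => y y1.
by rewrite (le_trans (T'le y))// ler_piMr// opnorm_ge0.
Qed.

Lemma adjoint_involution : involution (adjoint dot).
Proof.
split.
- move=> T; apply: adjoint_unique => x y.
  by rewrite dotC -adjointP -dotC.
- by move=> S T; apply: adjoint_unique => x y; rewrite linearDl linearDr/= !adjointP.
- by move=> S T; apply: adjoint_unique => x y; rewrite /= !adjointP.
- exact: adjoint_unique.
Qed.

End Adjoint.

Section KreinAdjoint.
Context {R : realType} {H : completeNormedModType R[i]}.
Variable dot : {dot H for Num.conj}.
Hypothesis hilbertH : hilbert_norm dot.
Variable J : 'L(H).
Hypothesis symJ : symmetry dot J.

(** [T^#] is the adjoint conjugated by [J], and [J] is self-adjoint with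
    square 1, so the rules of the adjoint carry over. *)
Lemma krein_involution : involution (krein_adjoint dot J).
Proof.
have [JJ J2] := symJ; have [adjK adjD adjM adj1] := adjoint_involution hilbertH.
rewrite /krein_adjoint; split.
- by move=> T; rewrite !adjM adjK -JJ !mulrA J2 mul1r -mulrA J2 mulr1.
- by move=> S T; rewrite adjD mulrDr mulrDl.
- by move=> S T; rewrite adjM !mulrA -(mulrA _ J J) J2 mulr1.
- by rewrite adj1 mulr1.
Qed.

(** The adjoint is additive and does not increase norms. *)
Lemma cvg_adjoint {I : Type} (F : set_system I) {FF : Filter F}
    (f : I -> 'L(H)) (a : 'L(H)) :
  f @ F --> a -> (fun i => adjoint dot (f i)) @ F --> adjoint dot a.
Proof.
have [_ adjD _ _] := adjoint_involution hilbertH.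
move=> fa; apply/cvgrPdist_lt => e e0; near=> i.
have -> : adjoint dot a - adjoint dot (f i) = adjoint dot (a - f i).
  by apply/(addIr (adjoint dot (f i))); rewrite -adjD !subrK.
rewrite (le_lt_trans (adjoint_norm hilbertH _))//.
by near: i; move/cvgrPdist_lt: fa; exact.
Unshelve. all: by end_near.
Qed.

Lemma cvg_krein_adjoint {I : Type} (F : set_system I) {FF : Filter F}
    (f : I -> 'L(H)) (a : 'L(H)) :
  f @ F --> a -> (fun i => krein_adjoint dot J (f i)) @ F --> krein_adjoint dot J a.
Proof.
move=> fa; apply: (@cvg_bopM _ _ _ F _ (fun i => J * adjoint dot (f i)) (fun=> J)).
  apply: (@cvg_bopM _ _ _ F _ (fun=> J)); first exact: cvg_cst.
  exact: cvg_adjoint.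
exact: cvg_cst.
Qed.

Lemma cvg_proj_intertwiner {I : Type} (F : set_system I) {FF : Filter F}
    (f : I -> 'L(H)) (a q : 'L(H)) : f @ F --> a ->
  (fun i => proj_intertwiner (krein_adjoint dot J) (f i) q) @ F -->
    proj_intertwiner (krein_adjoint dot J) a q.
Proof.
move=> fa; have cvg_term k :
    (fun i => corner (krein_adjoint dot J) (f i) k * corner (krein_adjoint dot J) q k)
      @ F --> corner (krein_adjoint dot J) a k * corner (krein_adjoint dot J) q k.
  apply: (@cvg_bopM _ _ _ F _ _ (fun=> corner (krein_adjoint dot J) q k));
    last exact: cvg_cst.
  apply: cvg_bopM; apply: cvg_proj_side => //; exact: cvg_krein_adjoint.
rewrite /proj_intertwiner sum_bool_pair.
under eq_fun do rewrite sum_bool_pair.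
by apply: cvgD; apply: cvgD; exact: cvg_term.
Qed.

End KreinAdjoint.

(** * The cross section *)

(** A projection acts as the identity on its range. *)
Lemma mul_proj_range {R : realType} {H : normedModType R[i]} (p q : 'L(H)) :
  p * p = p -> range q `<=` range p -> p * q = q.
Proof.
move=> pp qp; apply: bopP => x.
have [y _ pyqx] := qp _ (imageT q x).
by rewrite -[LHS]/(p (q x)) -pyqx -[LHS]/((p * p) y) pp.
Qed.

Section CrossSection.
Context {R : realType} {H : completeNormedModType R[i]}.
Variable dot : {dot H for Num.conj}.
Hypothesis hilbertH : hilbert_norm dot.
Variable J : 'L(H).
Hypothesis symJ : symmetry dot J.
Variables (S : set H) (Q0 : 'L(H)).
Hypothesis Q0S : J_normal_projections dot J S Q0.

Let star := krein_adjoint dot J.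
Let starP : involution star := krein_involution hilbertH symJ.
Let rangeQ0 : range Q0 = S. Proof. by case: Q0S. Qed.

Lemma conj_map_normal_projection U :
  J_unitaries dot J S U -> J_normal_projections dot J S (conj_map dot J Q0 U).
Proof.
move=> [_ VU US]; have [Q00 Q0C _] := Q0S.
have [UQ0U UQ0C] := conj_normal_projection starP VU (conj Q00 Q0C).
split; [exact: UQ0U|exact: UQ0C|apply/seteqP; split=> [_ [x _ <-]|y Sy]].
  have SQ0 : S (Q0 (star U x)) by rewrite -rangeQ0; exists (star U x).
  by rewrite -US; exists (Q0 (star U x)).
have [z Sz <-] : (U @` S) y by rewrite US.
have [w _ <-] : range Q0 z by rewrite rangeQ0.
exists (U w); first by [].
exact: (congr1 (fun T : 'L(H) => U (Q0 (T w))) VU).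
Qed.

Section AtProjection.
Variable Q : 'L(H).
Hypothesis QS : J_normal_projections dot J S Q.

Let U := proj_intertwiner star Q Q0.

Let QN : normal_projection star Q. Proof. by case: QS. Qed.
Let Q0N : normal_projection star Q0. Proof. by case: Q0S. Qed.
Let rangeQ : range Q = S. Proof. by case: QS. Qed.
Let QQ0 : Q * Q0 = Q0.
Proof. by apply: mul_proj_range; [case: QN|rewrite rangeQ rangeQ0]. Qed.
Let Q0Q : Q0 * Q = Q.
Proof. by apply: mul_proj_range; [case: Q0N|rewrite rangeQ rangeQ0]. Qed.
Let UV : U * star U = 1.
Proof.
rewrite (star_proj_intertwiner starP QN Q0N).
exact: (mul_proj_intertwiner starP QN Q0N QQ0 Q0Q).
Qed.
Let UQ0 : U * Q0 = Q * U. Proof. exact: proj_intertwinerE. Qed.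

(** [U] maps the range of [Q0] onto that of [Q] because [U Q0 = Q U] and [U]
    is invertible; both ranges are [S]. *)
Lemma intertwiner_J_unitary : J_unitaries dot J S U.
Proof.
have VU : star U * U = 1.
  rewrite (star_proj_intertwiner starP QN Q0N).
  exact: (mul_proj_intertwiner starP Q0N QN Q0Q QQ0).
split; [exact: UV|exact: VU|apply/seteqP; split=> [_ [z Sz <-]|y Sy]].
  have [w _ <-] : range Q0 z by rewrite rangeQ0.
  rewrite -rangeQ; exists (U w); first by [].
  exact: (esym (congr1 (fun T : 'L(H) => T w) UQ0)).
have [x _ <-] : range Q y by rewrite rangeQ.
exists (Q0 (star U x)); first by rewrite -rangeQ0; exists (star U x).
have UQ0V : U * Q0 * star U = Q by rewrite UQ0 -mulrA UV mulr1.
exact: (congr1 (fun T : 'L(H) => T x) UQ0V).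
Qed.

Lemma conj_map_intertwiner : conj_map dot J Q0 U = Q.
Proof. by rewrite /conj_map -/star UQ0 -mulrA UV mulr1. Qed.

End AtProjection.
End CrossSection.

Theorem proposition5p5 (R : realType) (H : completeNormedModType R[i])
  (dot : {dot H for Num.conj}) (hilbertH : hilbert_norm dot)
  (sepH : separable_space H)
  (J : 'L(H)) (symJ : symmetry dot J)
  (S : set H) (prS : pseudo_regular dot J S)
  (Q0 : 'L(H)) (Q0S : J_normal_projections dot J S Q0) :
  set_fun (J_unitaries dot J S) (J_normal_projections dot J S)
    (conj_map dot J Q0) /\
  exists s : 'L(H) -> 'L(H),
    [/\ set_fun (J_normal_projections dot J S) (J_unitaries dot J S) s,
        {within J_normal_projections dot J S, continuous s} &
        forall Q, J_normal_projections dot J S Q ->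
          conj_map dot J Q0 (s Q) = Q].
Proof.
split; first by move=> U; exact: conj_map_normal_projection.
exists (fun Q => proj_intertwiner (krein_adjoint dot J) Q Q0); split.
- by move=> Q; exact: intertwiner_J_unitary.
- apply: continuous_subspaceT => Q.
  exact: (@cvg_proj_intertwiner _ _ _ hilbertH J _ (nbhs Q) _ id).
- by move=> Q; exact: conj_map_intertwiner.
Qed.
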